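(* Let $d\ge 1$ and let $G\subseteq F(E,d)$ be the set of good direction sets $(u_1,\dots,u_d)$. Then $G$ is a dense $G_\delta$ set in $F(E,d)$.
   Context: $S^1\subset\mathbb{R}^2$ is the unit circle and $E\subset S^1$ is the set of points of $S^1$ whose principal argument lies in $[0,\pi)$. $F(E,d)=\{(u_1,\dots,u_d)\mid u_j\in E,\ u_i\ne u_j \text{ for } 1\le i<j\le d\}$ is the configuration space of $d$-tuples of distinct elements of $E$, topologized as a subspace of $E^d$ with the product topology. An element $(u_1,\dots,u_d)\in F(E,d)$ is a good set of directions if, whenever $(a_1,\dots,a_d)\in\mathbb{Z}^d$ and $\sum_{k=1}^d a_ku_k\in S^1$, all but one of the $a_j$ are zero. A $G_\delta$ set is a countable intersection of open sets. *)

(* Defs.v *)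
From mathcomp Require Import all_boot all_order all_algebra.
From mathcomp Require Import all_classical all_reals all_analysis.

Import Order.TTheory GRing.Theory Num.Theory.
Import numFieldNormedType.Exports.

Local Open Scope classical_set_scope.
Local Open Scope ring_scope.

(* The Euclidean length; the library norm on R * R is the sup norm. *)
Definition norm2 {R : realType} (p : R * R) : R :=
  Num.sqrt (p.1 ^+ 2 + p.2 ^+ 2).

Definition unit_circle (R : realType) : set (R * R) := [set p | norm2 p = 1].

(* A relation, since the argument is undefined at the origin; for p <> 0 there
   is exactly one such t. *)
Definition is_principal_arg {R : realType} (p : R * R) (t : R) : Prop :=
  - pi < t <= pi /\ p = (norm2 p * cos t, norm2 p * sin t).

Definition half_circle (R : realType) : set (R * R) :=
  [set p | unit_circle R p /\ exists2 t, is_principal_arg p t & 0 <= t < pi].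

(* half_circle R is coerced to the subtype set_type (half_circle R), which
   carries the subspace topology. *)
Definition half_circle_pow (R : realType) (d : nat) : topologicalType :=
  prod_topology (fun _ : 'I_d => half_circle R).

Definition config (R : realType) (d : nat) : set (half_circle_pow R d) :=
  [set u | forall i j : 'I_d, (i < j)%N -> u i <> u j].

Definition good_directions {R : realType} {d : nat} (u : 'I_d -> R * R) : Prop :=
  forall a : 'I_d -> int,
    unit_circle R (\sum_(k < d) u k *~ a k) -> exists! j, a j <> 0.

(* config R d is again coerced to its subtype, so this is a subset of the space
   F(E,d); the inner set_val goes to E^d, the outer one to the plane. *)
Definition good_set (R : realType) (d : nat) : set (config R d) :=
  [set u | good_directions (fun k : 'I_d => set_val (set_val u k))].

(* Main.v *)
Require Import Defs.
From mathcomp Require Import all_boot all_order all_algebra.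
From mathcomp Require Import all_classical all_reals all_analysis borel_hierarchy.
From mathcomp Require Import ring.

(** For a fixed integer vector [a] with sum [s(u) = \sum_k a_k u_k], the
    condition [|s(u)| <> 1] is open in [u] because [s] is continuous.  The good
    sets of directions form the intersection of these open conditions over the
    countably many [a] that do not have exactly one nonzero entry, hence a
    G_delta.

    Density needs no category argument: the directions are perturbed one at a
    time.  Suppose that the first [m] directions are linearly independent over
    the integers and form a good set.  For each [a] with [a_m <> 0], write [v]
    for the part of the sum that does not involve the direction [x] at index
    [m].  The equation [v + a_m x = 0] holds for one [x], and, if [v <> 0],
    [|v + a_m x| = 1] cuts the unit circle in at most two points, since it
    prescribes the inner product of [v] and [x] ([finite_circle_fiber]).  So
    only countably many [x] must be avoided ([countable_bad_directions]); if [x]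
    avoids them, then the first [m + 1] directions are again independent and good
    ([good_upto_extend]), the case [v = 0] being settled by independence.  Every
    nonempty open subset of the half circle contains an arc, which is uncountable
    ([open_half_circle_avoids_countable]), and changing one coordinate is
    continuous, so the new direction can be chosen without leaving a given open
    set of configurations.  Independence of the final family shows that its
    members are distinct. *)

Import Order.TTheory GRing.Theory Num.Theory.
Import numFieldNormedType.Exports.

Local Open Scope classical_set_scope.
Local Open Scope ring_scope.

(** * The Euclidean plane *)

Lemma norm2_eq1 (R : realType) (p : R * R) :
  norm2 p = 1 <-> p.1 ^+ 2 + p.2 ^+ 2 = 1.
Proof.
rewrite /norm2; split=> [h|->]; last by rewrite sqrtr1.
by rewrite -[LHS]sqr_sqrtr ?h ?expr1n// addr_ge0// sqr_ge0.
Qed.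

Lemma norm2_0 (R : realType) : norm2 (0 : R * R) = 0.
Proof. by rewrite /norm2 /= expr0n/= addr0 sqrtr0. Qed.

Lemma norm2_continuous (R : realType) : continuous (@norm2 R).
Proof.
move=> p; apply: (@continuous_comp _ _ _ (fun q : R * R => q.1 ^+ 2 + q.2 ^+ 2));
  last exact: sqrt_continuous.
by apply: cvgD; apply: (@continuous_comp _ _ _ _ (fun x : R => x ^+ 2));
  (try exact: exprn_continuous); [exact: cvg_fst|exact: cvg_snd].
Qed.

Lemma pairMz (R : realType) (p : R * R) (n : int) :
  p *~ n = (p.1 * n%:~R, p.2 * n%:~R).
Proof. by rewrite -scaler_int [p in LHS]surjective_pairing; congr pair; rewrite mulrC. Qed.

Lemma pairMz_continuous (R : realType) (n : int) :
  continuous (fun p : R * R => p *~ n).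
Proof.
rewrite (_ : (fun p => _) = (fun p : R * R => (n%:~R : R) *: p)).
  exact: scaler_continuous.
by apply/funext => p; rewrite scaler_int.
Qed.

(** * Open subsets of the half circle *)

Lemma half_circle_norm2 (R : realType) (x : half_circle R) :
  norm2 (set_val x) = 1.
Proof. by case: x => p /= pE; have [] := set_mem pE. Qed.

Lemma half_circle_cos_sin (R : realType) (t : R) :
  0 <= t < pi -> half_circle R (cos t, sin t).
Proof.
move=> /andP[t0 tpi].
have n1 : norm2 (cos t, sin t) = 1 by apply/norm2_eq1; rewrite /= cos2Dsin2.
split=> //; exists t; last by rewrite t0.
rewrite /is_principal_arg n1 !mul1r; split=> //.
by rewrite (ltW tpi) andbT (lt_le_trans _ t0)// oppr_lt0 pi_gt0.
Qed.

Lemma itv_uncountable (R : realType) (a b : R) :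
  a < b -> ~ countable [set` `[a, b[].
Proof.
move=> ab cI; have := countable_lebesgue_measure0 cI.
rewrite lebesgue_measure_itv/= lte_fin ab => /eqP.
by rewrite -EFinB eqe subr_eq0 gt_eqF.
Qed.

Lemma open_half_circle_avoids_countable (R : realType)
    (V : set (half_circle R)) (C : set (R * R)) (x : half_circle R) :
  open V -> V x -> countable C -> exists2 y, V y & ~ C (set_val y).
Proof.
move=> [W oW <-{V}] Wx cC.
have [_ [t [_ xE] /andP[t0 tpi]]] : half_circle R (set_val x).
  by case: (x) => p /= pE; exact: set_mem pE.
rewrite half_circle_norm2 !mul1r in xE.
have cc : continuous (fun t : R => (cos t, sin t)).
  by move=> s; apply: (@cvg_pair _ _ _ (nbhs s) (nbhs (cos s)) (nbhs (sin s)));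
    [exact: continuous_cos|exact: continuous_sin].
have : nbhs t ((fun t : R => (cos t, sin t)) @^-1` W).
  by apply: cc; apply: open_nbhs_nbhs; split=> //; rewrite -xE.
move=> /nbhs_ballP[e /= e0 eW].
apply: contrapT => noy.
have tm : t < Num.min (t + e) pi by rewrite lt_min ltrDl e0 tpi.
apply: (itv_uncountable R _ _ tm).
apply: (@sub_countable _ _ _ [set acos p.1 | p in C]); last first.
  by apply: sub_countable cC; exact: card_image_le.
apply: subset_card_le => s /=; rewrite in_itv/= lt_min => /and3P[ts se spi].
have s0 := le_trans t0 ts.
exists (cos s, sin s); last by rewrite /= cosK// in_itv/= s0 ltW.
apply: contrapT => nC; apply: noy.
have hs : half_circle R (cos s, sin s) by apply: half_circle_cos_sin; rewrite s0.
exists (exist _ (cos s, sin s) (mem_set hs)) => //.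
by apply: eW; rewrite /ball/= ler0_norm ?subr_le0// opprB ltrBlDl.
Qed.

(** * Directions to be avoided *)

Lemma finite_circle_fiber (R : realType) (v : R * R) (n : int) :
  v <> 0 -> n <> 0 ->
  finite_set [set x | norm2 x = 1 /\ norm2 (v + x *~ n) = 1].
Proof.
case: v => v1 v2 v0 n0.
pose N := v1 ^+ 2 + v2 ^+ 2; pose r : R := n%:~R.
have r0 : r != 0 by rewrite intr_eq0; apply/eqP.
have N0 : N != 0.
  apply/eqP => /eqP; rewrite /N paddr_eq0 ?sqr_ge0// !sqrf_eq0.
  by move=> /andP[/eqP v10 /eqP v20]; apply: v0; rewrite v10 v20.
(* [c] is the prescribed inner product of [v] and [x]; [s] below is their
   determinant, which together with [c] determines [x]. *)
pose c := (1 - r ^+ 2 - N) / (2 * r); pose D := N - c ^+ 2.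
pose f (s : R) := ((v1 * c - v2 * s) / N, (v2 * c + v1 * s) / N).
apply: (@sub_finite_set _ _ [set f (Num.sqrt D); f (- Num.sqrt D)]); last first.
  by rewrite finite_setU; split; exact: finite_set1.
move=> [x1 x2] /= []; rewrite !norm2_eq1 pairMz /= -/r => x_eq vx_eq.
have cE : v1 * x1 + v2 * x2 = c.
  have -> : v1 * x1 + v2 * x2 = ((v1 + x1 * r) ^+ 2 + (v2 + x2 * r) ^+ 2
      - r ^+ 2 * (x1 ^+ 2 + x2 ^+ 2) - N) / (2 * r) by rewrite /N; field.
  by rewrite vx_eq x_eq mulr1.
pose s := v1 * x2 - v2 * x1.
have xE : (x1, x2) = f s by rewrite /f -cE /s; congr pair; rewrite /N; field.
have sE : s ^+ 2 = D.
  by rewrite /D -cE -[N]mulr1 -x_eq /s /N; ring.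
have : s ^+ 2 == Num.sqrt D ^+ 2 by rewrite sqr_sqrtr -sE ?sqr_ge0.
by rewrite eqf_sqr xE => /orP[] /eqP ->; [left|right].
Qed.

(** The points [x] of the unit circle such that, when [x] replaces the [i]-th
    direction, some integer combination with nonzero coefficient at [i] vanishes,
    or has length 1 while its part away from [i] does not vanish.  Integer
    vectors are finite functions here, which makes the union countable. *)
Definition bad_directions {R : realType} {d : nat} (u : 'I_d -> R * R)
    (i : 'I_d) : set (R * R) :=
  \bigcup_(a in [set a : {ffun 'I_d -> int} | a i <> 0])
    [set x | norm2 x = 1 /\
      let v := \sum_(k < d | k != i) u k *~ a k in
      v + x *~ a i = 0 \/ (v <> 0 /\ norm2 (v + x *~ a i) = 1)].

Lemma countable_bad_directions (R : realType) (d : nat) (u : 'I_d -> R * R)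
  (i : 'I_d) : countable (bad_directions u i).
Proof.
apply: bigcup_countable => [|a /= ai0]; first exact: countableP.
set v := \sum_(k < d | _) _.
have r0 : (a i)%:~R != 0 :> R by rewrite intr_eq0; apply/eqP.
pose S := [set - ((a i)%:~R^-1 *: v)] `|`
  (if v == 0 then set0 else [set x | norm2 x = 1 /\ norm2 (v + x *~ a i) = 1]).
apply: (@sub_countable _ _ _ S).
  apply: subset_card_le => x /= [x1 [vx|[v0 vx]]]; [left|right].
    rewrite /= -scalerN (_ : - v = (a i)%:~R *: x) ?scalerK//.
    by rewrite scaler_int; apply/eqP; rewrite eq_sym -addr_eq0 addrC vx.
  by rewrite ifN//; apply/eqP.
apply: finite_set_countable; rewrite finite_setU; split; first exact: finite_set1.
case: eqP => v0; first exact: finite_set0.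
exact: finite_circle_fiber.
Qed.

(** The first [m] directions are linearly independent over the integers and
    form a good set; the condition ranges over the integer vectors supported on
    the indices below [m]. *)
Definition good_upto {R : realType} {d : nat} (m : nat) (u : 'I_d -> R * R) :=
  forall a : 'I_d -> int, (forall k : 'I_d, (m <= k)%N -> a k = 0) ->
    (\sum_(k < d) u k *~ a k = 0 -> forall k, a k = 0) /\
    (norm2 (\sum_(k < d) u k *~ a k) = 1 -> exists! j, a j <> 0).

Lemma good_upto0 (R : realType) (d : nat) (u : 'I_d -> R * R) : good_upto 0 u.
Proof.
move=> a a0; split=> [_ k|]; first exact: a0.
rewrite big1 => [|k _]; last by rewrite a0// mulr0z.
by rewrite norm2_0 => /eqP; rewrite eq_sym oner_eq0.
Qed.

Lemma good_upto_extend (R : realType) (d : nat) (u w : 'I_d -> R * R)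
    (i : 'I_d) :
  (forall k, k != i -> w k = u k) -> norm2 (w i) = 1 ->
  ~ bad_directions u i (w i) -> good_upto i u -> good_upto i.+1 w.
Proof.
move=> wu wi1 nbad gu a asupp.
pose b (k : 'I_d) : int := if k == i then 0 else a k.
have bsupp (k : 'I_d) : (i <= k)%N -> b k = 0.
  rewrite /b leq_eqVlt eq_sym => /orP[ki|ik]; first by rewrite ifT.
  by case: eqP => // _; exact: asupp.
pose v := \sum_(k < d | k != i) u k *~ a k.
have vb : \sum_(k < d) u k *~ b k = v.
  rewrite (bigD1 i)//= /b eqxx mulr0z add0r.
  by apply: eq_bigr => k /negbTE ->.
have wE : \sum_(k < d) w k *~ a k = v + w i *~ a i.
  rewrite (bigD1 i)//= addrC; congr (_ + _).
  by apply: eq_bigr => k ki; rewrite wu.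
have [b0 b1] := gu b bsupp; rewrite vb in b0 b1.
rewrite wE; have [ai0|/eqP ai0] := eqVneq (a i) 0.
  have ab : a = b by apply/funext => k; rewrite /b; case: eqP => // ->.
  by rewrite ai0 mulr0z addr0 ab; split.
have nb (P : Prop) : v + w i *~ a i = 0 \/ v <> 0 /\ norm2 (v + w i *~ a i) = 1 -> P.
  move=> h; exfalso; apply: nbad; exists (finfun a); first by rewrite /= ffunE.
  split=> //=; rewrite ffunE.
  by rewrite (eq_bigr (fun k => u k *~ a k)) // => k _; rewrite ffunE.
split=> [v0|v1]; first by apply: nb; left.
have [v0|/eqP v0] := eqVneq v 0; last by apply: nb; right.
exists i; split=> // j aj; apply/esym/eqP/negPn/negP => ji.
by apply: aj; move: (b0 v0 j); rewrite /b (negbTE ji).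
Qed.

(** * Openness and density *)

Lemma set_val_continuous (X : topologicalType) (A : set X) :
  continuous (set_val : A -> X).
Proof. exact: initial_continuous. Qed.

Lemma direction_continuous (R : realType) (d : nat) (k : 'I_d) :
  continuous (fun u : config R d => set_val (set_val u k) : R * R).
Proof.
move=> u.
apply: (@continuous_comp _ (half_circle_pow R d) _ set_val
  (fun w => set_val (w k) : R * R)); first exact: set_val_continuous.
apply: (@continuous_comp (half_circle_pow R d) (half_circle R) _ (proj k) set_val).
  exact: proj_continuous.
exact: set_val_continuous.
Qed.

Lemma combination_continuous (R : realType) (d : nat) (a : 'I_d -> int) :
  continuous (fun u : config R d =>
    \sum_(k < d) set_val (set_val u k) *~ a k : R * R).
Proof.
apply: continuous_big => [|k _]; first exact: add_continuous.
move=> u; exact: (@continuous_comp (config R d) (R * R)%type (R * R)%type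
  (fun w => set_val (set_val w k)) (fun p => p *~ a k) u
  (direction_continuous _ _ k u) (pairMz_continuous _ _ _)).
Qed.

(** The open sets are indexed by [nat] through the encoding of integer vectors;
    numbers that encode no vector, and vectors with exactly one nonzero entry,
    contribute the full space. *)
Lemma Gdelta_good_set (R : realType) (d : nat) : Gdelta (good_set R d).
Proof.
pose F (a : {ffun 'I_d -> int}) : set (config R d) :=
  if pselect (exists! j, a j <> 0) then setT
  else [set u | norm2 (\sum_(k < d) set_val (set_val u k) *~ a k) <> 1].
have oF a : open (F a).
  rewrite /F; case: pselect => [?|?]; first exact: openT.
  rewrite (_ : [set _ | _] = (@norm2 R \o (fun u : config R d =>
    \sum_(k < d) set_val (set_val u k) *~ a k)) @^-1` ~` [set 1]) //.
  apply: open_comp => [u _|].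
    by apply: continuous_comp;
      [exact: combination_continuous|exact: norm2_continuous].
  by apply: closed_openC; exact: closed_eq.
exists (fun n => if unpickle n is Some a then F a else setT) => [n|].
  by case: unpickle => [a|]; [exact: oF|exact: openT].
apply/seteqP; split=> u.
  move=> gu n _; case: unpickle => [a|//]; rewrite /F; case: pselect => // nea /= e.
  by apply: nea; exact: gu.
move=> Fu a ua; apply: contrapT => na.
have := Fu (pickle (finfun a)) Logic.I; rewrite pickleK /F.
rewrite (_ : fun_of_fin (finfun a) = a); last by apply/funext => k; rewrite ffunE.
by case: pselect => //= _; exact.
Qed.

Lemma dense_good_set (R : realType) (d : nat) : dense (good_set R d).
Proof.
move=> O [u0 Ou0] [W oW WO]; rewrite -WO in Ou0 *.
have step m : (m <= d)%N -> exists2 u : half_circle_pow R d,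
    W u & good_upto m (fun k => set_val (u k)).
  elim: m => [|m IH] md.
    by exists (set_val u0) => //; exact: good_upto0.
  have [u Wu gu] := IH (ltnW md).
  pose i := Ordinal md.
  have oV : open ((fun x : half_circle R => dfwith u i x : half_circle_pow R d) @^-1` W).
    by apply: open_comp => // x _; exact: dfwith_continuous.
  have Vu : ((fun x : half_circle R => dfwith u i x : half_circle_pow R d) @^-1` W) (u i).
    rewrite /= (_ : dfwith u i (u i) = u)//.
    by apply: functional_extensionality_dep => k; case: dfwithP.
  have [y Wy yC] := open_half_circle_avoids_countable _ _ _ _ oV Vu
    (countable_bad_directions _ _ (fun k => set_val (u k)) i).
  exists (dfwith u i y) => //.
  apply: (good_upto_extend _ _ (fun k => set_val (u k)) _ i) => //.
  - by move=> k ki; rewrite dfwithout// eq_sym.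
  - exact: half_circle_norm2.
  - by rewrite dfwithin.
have [u Wu gu] := step d (leqnn d).
have uc : config R d u.
  (* Equal directions at [i < j] would give the vanishing combination
     [u_i - u_j]. *)
  move=> i j ij uij.
  have ji : j != i by rewrite gt_eqF.
  pose a (k : 'I_d) : int := (k == i)%:Z - (k == j)%:Z.
  have [|a0 _] := gu a; first by move=> k; rewrite leqNgt ltn_ord.
  suff : a i = 0 by rewrite /a eqxx eq_sym (negbTE ji).
  apply: a0; rewrite (bigD1 i)//= (bigD1 j)//= big1 ?addr0 => [|k /andP[ki kj]].
    by rewrite /a !eqxx (negbTE ji) eq_sym (negbTE ji) uij subr0 sub0r mulrNz subrr.
  by rewrite /a (negbTE ki) (negbTE kj) subrr mulr0z.
exists (exist _ u (mem_set uc)); split=> // a ua.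
by apply: (gu a _).2 => // k; rewrite leqNgt ltn_ord.
Qed.

Theorem theorem2p6 (R : realType) (d : nat) (hd : (1 <= d)%N) :
  dense (good_set R d) /\ Gdelta (good_set R d).
Proof. by split; [exact: dense_good_set|exact: Gdelta_good_set]. Qed.
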